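(* Let $\mathcal{S}$ be a sparse set of positive integers. For every even base $b$, there are uncountably many numbers $x\in\mathcal{C}(\mathcal{S})$ such that $x$ is not normal in any even base $b'\le b$.
   Context: $\log$ is the natural logarithm. For a set $\mathcal{S}$ of positive integers and integers $a,c$, $S(a,c)=\#(\mathcal{S}\cap[a,c])$, where $[a,c]$ is the set of integers between $a$ and $c$ inclusive. The set $\mathcal{S}$ is called sparse if it has (asymptotic) density zero and there exists a real number $\rho>0$ (called a sparsity exponent) such that $$\liminf_{k\to\infty}\ \min_{0\le a\le k^{\rho}}\frac{S(a,a+k)}{30\log k}>1,$$ where $k$ and $a$ range over integers. The sparse Cantor set is $\mathcal{C}(\mathcal{S})=\{x\in[0,1): x=\sum_{k\in\mathcal{S}} b_k2^{-k},\ b_k\in\{0,1\}\}$. A base is an integer $\ge 2$. The base-$b$ expansion of a real $x$ is the digit sequence $b_1(x),b_2(x),\dots\in\{0,\dots,b-1\}$ with $x=\lfloor x\rfloor+\sum_{j\ge1}b_j(x)b^{-j}$ that does not end with a tail of digits $b-1$. A real number $x$ is simply normal in base $b$ if each digit $0,\dots,b-1$ occurs with asymptotic frequency $1/b$ in its base-$b$ expansion, and normal in base $b$ if it is simply normal in base $b^k$ for every $k\ge1$. *)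

(* Defs.v *)
From mathcomp Require Import all_boot all_order all_algebra.
From mathcomp Require Import all_classical all_reals all_analysis.
Import Order.TTheory GRing.Theory Num.Theory numFieldNormedType.Exports.

Set Implicit Arguments.
Unset Strict Implicit.
Unset Printing Implicit Defensive.

Local Open Scope classical_set_scope.
Local Open Scope ring_scope.

(* S(a, c), the number of elements of S in the integer interval [a, c]. *)
Definition count_between (S : set nat) (a c : nat) : nat :=
  (\sum_(a <= n < c.+1) `[< S n >])%N.

Definition density_zero (R : realType) (S : set nat) : Prop :=
  (fun n : nat => (count_between S 1 n)%:R / n%:R : R) @ \oo --> (0 : R).

(* The infimum ranges over a finite nonempty set of integers a, hence is a
   minimum. The terms k = 0 and k = 1, where 30 log k = 0 in R, do not affect
   the lower limit. *)
Definition window_min (R : realType) (S : set nat) (rho : R) (k : nat) :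
    \bar R :=
  ereal_inf [set ((count_between S a (a + k))%:R / (30 * ln k%:R))%:E
            | a in [set a : nat | a%:R <= k%:R `^ rho]].

Definition sparse (R : realType) (S : set nat) : Prop :=
  density_zero R S /\
  exists2 rho : R, 0 < rho & (1 < limn_einf (window_min S rho))%E.

Definition cantor_set (R : realType) (S : set nat) : set R :=
  [set x : R | 0 <= x < 1 /\
    exists beta : nat -> bool,
      series (fun k => (`[< S k >] && beta k)%:R * 2 ^- k) @ \oo --> x].

(* d is the base-b expansion of x; since sequences start at 0, the value d j
   is the digit b_(j+1)(x), of weight b^-(j+1). *)
Definition is_expansion (R : realType) (b : nat) (x : R) (d : nat -> 'I_b) :
    Prop :=
  series (fun j => (d j)%:R * b%:R ^- j.+1) @ \oo
    --> x - (Num.floor x)%:~R /\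
  ~ (\forall j \near \oo, d j = b.-1 :> nat).

Definition simply_normal_in_base (R : realType) (b : nat) (x : R) : Prop :=
  exists2 d : nat -> 'I_b, is_expansion x d &
    forall a : 'I_b,
      (fun n : nat => (\sum_(0 <= j < n) (d j == a))%N%:R / n%:R : R) @ \oo
        --> (b%:R^-1 : R).

Definition normal_in_base (R : realType) (b : nat) (x : R) : Prop :=
  forall k : nat, (1 <= k)%N -> simply_normal_in_base (b ^ k) x.

(* Main.v *)
Require Import Defs.
From mathcomp Require Import all_boot all_order all_algebra.
From mathcomp Require Import all_classical all_reals all_analysis.
From mathcomp Require Import zify ring lra.
Import Order.TTheory GRing.Theory Num.Theory numFieldNormedType.Exports.

Local Open Scope classical_set_scope.
Local Open Scope ring_scope.

(** The numbers x are binary Liouville-like sums of 2^-t over lacunary subsets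
    of S.

    A sparse set is infinite ([sparse_unbounded]), so it contains a sequence
    t_0 < t_1 < ... with t_(i+1) > 3 b t_i + 1.  To each 0-1 sequence beta
    corresponds the point x of C(S) that is the sum of the 2^-t_i with
    beta_i = 1; its binary digits vanish at all the places strictly between t_i
    and t_(i+1).

    Let b' <= b be an even base and n = t_i.  The first n binary digits of x
    form a dyadic number whose denominator divides 2^n, hence also b'^n: it
    terminates after n digits in base b'.  The rest of x is less than
    b'^-(3n), because of the choice of t_(i+1).  So the base-b' digits of x in
    the places n+1, ..., 3n are all 0 ([trunc_gap]), and 0 has frequency at
    least 2/3 among the first 3n digits, for infinitely many n.  Since
    2/3 > 1/2 >= 1/b', the number x is not even simply normal in base b'
    ([not_simply_normal_of_gaps]).

    Digits are read off from integer parts throughout: as long as the expansion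
    does not end with a tail of digits b-1, the integer formed by the first n
    digits is the integer part of b^n x ([prefix_trunc]).  This gives the
    uniqueness of expansions as well, hence x determines beta; by Cantor's
    diagonal argument there are uncountably many such x. *)

(** * Finite prefixes of digit sequences *)

(** The integer whose base-[b] digits are [d 0], ..., [d n.-1], most
    significant first. *)
Fixpoint prefix (b : nat) (d : nat -> nat) (n : nat) : nat :=
  if n is n'.+1 then (b * prefix b d n' + d n')%N else 0%N.

Lemma prefix_ge (b : nat) (d : nat -> nat) (n k : nat) :
  (b ^ k * prefix b d n <= prefix b d (n + k))%N.
Proof.
elim: k => [|k IHk]; first by rewrite mul1n addn0.
rewrite addnS /= expnS -mulnA (leq_trans _ (leq_addr _ _)) //.
by rewrite leq_mul2l IHk orbT.
Qed.

Lemma prefix_lt (b : nat) (d : nat -> nat) (n k : nat) :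
  (forall j, (d j < b)%N) ->
  (prefix b d (n + k) < b ^ k * (prefix b d n).+1)%N.
Proof.
move=> d_lt; elim: k => [|k IHk]; first by rewrite mul1n addn0.
rewrite addnS /= expnS -mulnA.
apply: (@leq_trans (b * (prefix b d (n + k)).+1)); last first.
  by rewrite leq_mul2l IHk orbT.
by rewrite mulnS [leqRHS]addnC -addnS leq_add2l d_lt.
Qed.

Lemma prefix_gap (b : nat) (d : nat -> nat) (n k : nat) :
  (forall j, (n <= j < n + k)%N -> d j = 0%N) ->
  prefix b d (n + k) = (b ^ k * prefix b d n)%N.
Proof.
elim: k => [|k IHk] d0; first by rewrite mul1n addn0.
rewrite addnS /= d0 ?addn0; last by lia.
by rewrite IHk ?mulnA ?expnS // => j ?; apply: d0; lia.
Qed.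

(** Appending [m - n] digits multiplies the prefix by [b ^ (m - n)] and adds a
    nonnegative contribution from each of them, which can vanish in total only
    if every one of them is 0. *)
Lemma digits0_of_prefix (b : nat) (d : nat -> nat) (n m j : nat) : (0 < b)%N ->
  prefix b d m = (b ^ (m - n) * prefix b d n)%N -> (n <= j < m)%N -> d j = 0%N.
Proof.
move=> b_gt0 E /andP[nj jm].
have := prefix_ge b d j.+1 (m - j.+1); rewrite subnKC // E.
have /= -> : (m - n = (m - j.+1) + (j.+1 - n))%N by lia.
rewrite expnD -mulnA leq_pmul2l ?expn_gt0 ?b_gt0 //= subSn // expnS -mulnA.
have := prefix_ge b d n (j - n); rewrite subnKC // -(leq_pmul2l b_gt0); lia.
Qed.

Lemma digit_prefix (b : nat) (d : nat -> nat) (j : nat) :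
  d j = (prefix b d j.+1 - b * prefix b d j)%N.
Proof. by rewrite /= addKn. Qed.

(** * Digit expansions and integer parts *)

Lemma series_prefix (R : realType) (b : nat) (d : nat -> nat) (n : nat) :
  (0 < b)%N ->
  series (fun j => (d j)%:R * b%:R ^- j.+1 : R) n =
    (prefix b d n)%:R / b%:R ^+ n.
Proof.
move=> b_gt0; have b0 : b%:R != 0 :> R by rewrite pnatr_eq0 -lt0n.
elim: n => [|n IHn]; first by rewrite /series /= big_nil mul0r.
rewrite seriesSr IHn /= natrD natrM exprS; field.
by rewrite b0 expf_neq0.
Qed.

(** The digits from place n on contribute at most 1 to b^n x.  They would
    contribute exactly 1 only if all of them were b-1, so the upper bound is
    strict. *)
Lemma prefix_bounds (R : realType) (b : nat) (d : nat -> nat) (x : R) :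
  (forall j, (d j < b)%N) ->
  series (fun j => (d j)%:R * b%:R ^- j.+1) @ \oo --> x ->
  ~ (\forall j \near \oo, d j = b.-1) ->
  forall n, (prefix b d n)%:R <= b%:R ^+ n * x < (prefix b d n).+1%:R.
Proof.
move=> d_lt cvx not_tail n.
have b_gt0 : (0 < b)%N by apply: leq_ltn_trans (d_lt 0%N).
have bX (m : nat) : 0 < b%:R ^+ m :> R by rewrite exprn_gt0 // ltr0n.
have le_next m : b%:R ^+ m * x <= (prefix b d m).+1%:R.
  rewrite mulrC -ler_pdivlMr //; apply: (cvgr_to_le cvx).
  exists m => // k /= mk; rewrite series_prefix // ler_pdivrMr // mulrAC.
  rewrite ler_pdivlMr // -!natrX -!natrM ler_nat.
  have := prefix_lt b d m (k - m) d_lt; rewrite subnKC // => /ltnW.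
  have -> : (b ^ k = b ^ (k - m) * b ^ m)%N by rewrite -expnD subnK.
  by rewrite mulnA leq_pmul2r ?expn_gt0 ?b_gt0 // [leqRHS]mulnC.
have ge_prefix : (prefix b d n)%:R <= b%:R ^+ n * x.
  rewrite mulrC -ler_pdivrMr //; apply: (cvgr_to_ge cvx).
  exists n => // k /= nk; rewrite series_prefix // ler_pdivrMr // mulrAC.
  rewrite ler_pdivlMr // -!natrX -!natrM ler_nat.
  have := prefix_ge b d n (k - n); rewrite subnKC //.
  have -> : (b ^ k = b ^ (k - n) * b ^ n)%N by rewrite -expnD subnK.
  by rewrite mulnA leq_pmul2r ?expn_gt0 ?b_gt0 // [(prefix _ _ _ * _)%N]mulnC.
rewrite ge_prefix /=.
have [j nj dj] : exists2 j, (n <= j)%N & d j <> b.-1.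
  apply: contrapT => no_j; apply: not_tail; exists n => // j /= nj.
  by apply: contrapT => dj; apply: no_j; exists j.
(* The digit [d j] loses at least one unit of b^-(j+1) against the bound
   reached by a tail of digits b-1. *)
have lt_next : (prefix b d j.+1).+1%:R <
    b%:R ^+ (j.+1 - n) * (prefix b d n).+1%:R :> R.
  rewrite -natrX -natrM ltr_nat subSn // expnS -mulnA.
  have := prefix_lt b d n (j - n) d_lt; rewrite subnKC // -(leq_pmul2l b_gt0).
  apply: leq_trans => /=; move: dj (d_lt j); rewrite mulnS => ? ?; lia.
rewrite -(ltr_pM2l (bX (j.+1 - n)%N)) mulrA -exprD subnK; last by lia.
exact: le_lt_trans (le_next _) lt_next.
Qed.

Lemma prefix_trunc (R : realType) (b : nat) (d : nat -> nat) (x : R) :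
  (forall j, (d j < b)%N) ->
  series (fun j => (d j)%:R * b%:R ^- j.+1) @ \oo --> x ->
  ~ (\forall j \near \oo, d j = b.-1) ->
  forall n, prefix b d n = Num.trunc (b%:R ^+ n * x).
Proof.
by move=> d_lt cvx not_tail n; apply/esym/truncn_def/prefix_bounds.
Qed.

(** The hypothesis on integer parts says that the binary digits of x vanish from
    place n to place m.  Thus 2^n x exceeds its integer part N by less than
    2^(n-m).  With e = b/2, b^i x = b^(i-n) e^n (2^n x) exceeds the integer
    b^(i-n) e^n N by less than b^i / 2^m, which is at most 1 for i <= k, so that
    this integer is the integer part of b^i x. *)
Lemma trunc_gap (R : realType) (b n m k : nat) (x : R) :
  ~~ odd b -> (0 < b)%N -> 0 <= x -> (n <= k)%N -> (b ^ k <= 2 ^ m)%N ->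
  Num.trunc (2 ^+ m * x) = (2 ^ (m - n) * Num.trunc (2 ^+ n * x))%N ->
  Num.trunc (b%:R ^+ k * x) = (b ^ (k - n) * Num.trunc (b%:R ^+ n * x))%N.
Proof.
move=> b_even b_gt0 x_ge0 nk bk gap.
set N := Num.trunc (2 ^+ n * x) in gap.
have bE : (b = 2 * b./2)%N.
  by rewrite mul2n -[LHS]odd_double_half (negbTE b_even).
have nm : (n <= m)%N.
  rewrite -(@leq_exp2l 2) //; apply: leq_trans bk.
  apply: (@leq_trans (b ^ n)).
    by rewrite [in leqRHS]bE expnMn leq_pmulr // expn_gt0; lia.
  by rewrite leq_pexp2l.
have X2 (i : nat) : 0 < 2 ^+ i :> R by rewrite exprn_gt0.
have /andP[N_le _] := truncn_itv (mulr_ge0 (ltW (X2 n)) x_ge0).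
have /andP[_] := truncn_itv (mulr_ge0 (ltW (X2 m)) x_ge0).
rewrite gap => N_gt.
have truncE i : (n <= i <= k)%N ->
    Num.trunc (b%:R ^+ i * x) = (b ^ (i - n) * (b./2 ^ n * N))%N.
  move=> /andP[ni ik]; apply: truncn_def.
  have bi : b%:R ^+ i = (b ^ (i - n) * b./2 ^ n)%:R * 2 ^+ n :> R.
    rewrite -!natrX -natrM -mulnA -expnMn [(b./2 * 2)%N]mulnC -bE -expnD.
    by rewrite subnK.
  set c := (b ^ (i - n) * b./2 ^ n)%N in bi.
  have cle : (c * 2 ^ n <= 2 ^ m)%N.
    apply: leq_trans bk; rewrite /c -mulnA -expnMn [(b./2 * 2)%N]mulnC -bE.
    by rewrite -expnD subnK // leq_pexp2l.
  have c0 : (0 < c)%N by rewrite muln_gt0 !expn_gt0; lia.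
  rewrite mulnA -/c bi -mulrA natrM ler_pM2l ?ltr0n // N_le /=.
  rewrite -(ltr_pM2l (X2 (m - n)%N)) mulrCA [X in _ * X]mulrA -exprD subnK //.
  apply: (@lt_le_trans _ _ (c%:R * (2 ^ (m - n) * N).+1%:R)).
    by rewrite ltr_pM2l ?ltr0n.
  rewrite -!natrX -!natrM ler_nat.
  rewrite [(_ * N).+1]/= mulnS [(_ * (c * N).+1)%N]mulnS.
  rewrite mulnCA leq_add2r -(@leq_pmul2r (2 ^ n)) ?expn_gt0 //.
  by rewrite -expnD subnK.
by rewrite !truncE ?leqnn ?nk // subnn mul1n.
Qed.

(** * Long blocks of zeros preclude simple normality *)

Lemma not_simply_normal_of_gaps (R : realType) (b : nat) (x : R) :
  (2 <= b)%N -> 0 <= x < 1 ->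
  (forall n0, exists2 n, (n0 < n)%N &
    Num.trunc (b%:R ^+ (3 * n) * x) =
      (b ^ (2 * n) * Num.trunc (b%:R ^+ n * x))%N) ->
  ~ simply_normal_in_base b x.
Proof.
move=> b_ge2 x01 gaps [d [cvx not_tail] freq].
have b_gt0 : (0 < b)%N by lia.
have floor0 : Num.floor x = 0 by apply: floor_def; rewrite add0r.
rewrite floor0 subr0 in cvx.
have prefixE := @prefix_trunc R b (fun j => d j : nat) x
  (fun j => ltn_ord (d j)) cvx not_tail.
have b2 : b%:R^-1 < 2 / 3 :> R.
  apply: (@le_lt_trans _ _ 2^-1); last by lra.
  by rewrite lef_pV2 ?posrE ?ltr0n // ler_nat.
have [n0 _ /= lt23] := cvgr_lt _ (freq (Ordinal b_gt0)) _ b2.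
have [n n0n] := gaps n0.
rewrite -!prefixE => gap.
have := lt23 (3 * n)%N => /(_ ltac:(rewrite /=; lia)).
rewrite ltr_pdivrMr ?ltr0n; last by lia.
apply/negP; rewrite -leNgt natrM mulrA divfK // -natrM ler_nat.
rewrite (@big_cat_nat _ _ _ n) //=; last by lia.
apply: leq_trans (leq_addl _ _).
rewrite (eq_big_nat _ _ (F2 := fun=> 1%N)) => [|j jn].
  by rewrite sum_nat_const_nat; lia.
have := @digits0_of_prefix b (fun j => d j : nat) n (3 * n) j b_gt0.
have -> : (3 * n - n = 2 * n)%N by lia.
by move=> /(_ gap jn) dj; rewrite -val_eqE /= dj.
Qed.

(** * Sparse sets and lacunary binary sums *)

(** The windows [0, k] suffice: eventually they contain more than 30 log k
    elements, and log k tends to infinity. *)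
Lemma sparse_unbounded (R : realType) (S : set nat) :
  sparse R S -> forall N, exists2 n, (N <= n)%N & S n.
Proof.
move=> [_ [rho _]]; rewrite limn_einf_lim => /lt_le_trans liminf_gt N.
apply: contrapT => noS.
have : (1 < ereal_sup (range (einfs (window_min S rho))))%E.
  by apply: liminf_gt; rewrite (cvg_lim _ (@cvg_einfs_sup _ _)).
move=> /ereal_sup_gt[_ [K _ <-]] K_gt.
(* If S had no element at or above N, the window [0, k] would contain at most
   N elements, although log k > N. *)
pose k := (maxn K (Num.trunc (expR N%:R : R)).+1).
have k_gt : (1 < window_min S rho k)%E.
  apply: (lt_le_trans K_gt); apply: ereal_inf_lbound.
  by exists k => //=; rewrite leq_maxl.
have expNk : expR N%:R < k%:R :> R.
  by apply: lt_le_trans (truncnS_gt _) _; rewrite ler_nat leq_maxr.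
have lnk : N%:R < ln k%:R :> R.
  by rewrite -ltr_expR lnK // posrE (lt_trans (expR_gt0 _) expNk).
have : (1 < ((count_between S 0 (0 + k))%:R / (30 * ln k%:R))%:E :> \bar R)%E.
  apply: (lt_le_trans k_gt); apply: ereal_inf_lbound; exists 0%N => //=.
  exact: powR_ge0.
have ln0 : 0 < ln k%:R :> R by exact: le_lt_trans lnk.
rewrite lte_fin ltr_pdivlMr ?mulr_gt0 // mul1r; apply/negP; rewrite -leNgt.
apply: (@le_trans _ _ N%:R); last by lra.
rewrite ler_nat /count_between add0n.
apply: (@leq_trans (\sum_(0 <= n < k.+1) (n < N)%N)).
  apply: leq_sum => n _; case: asboolP => //= Sn.
  by rewrite lt0b ltnNge; apply/negP => Nn; apply: noS; exists n.
suff -> : (\sum_(0 <= n < k.+1) (n < N)%N = minn k.+1 N)%N by rewrite geq_minr.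
elim: k.+1 => [|m IHm]; first by rewrite big_nil min0n.
by rewrite big_nat_recr //= IHm; lia.
Qed.

Lemma binary_point (R : realType) (c : nat -> bool) :
  ~ (\forall j \near \oo, c j) ->
  exists x : R, 0 <= x < 1 /\
    series (fun j => (c j)%:R * 2 ^- j.+1) @ \oo --> x.
Proof.
move=> not_tail; pose u : R^nat := series (fun j => (c j)%:R * 2 ^- j.+1).
have uE n : u n = (prefix 2 c n)%:R / 2 ^+ n by rewrite -series_prefix.
have c_lt j : (c j < 2)%N by case: (c j).
have cvgu : cvgn u.
  apply: (@nondecreasing_is_cvgn R u).
    apply/nondecreasing_seqP => n; rewrite /u seriesSr lerDl.
    by rewrite mulr_ge0 // invr_ge0 exprn_ge0.
  exists 1 => _ [n _ <-]; rewrite uE ler_pdivrMr ?exprn_gt0 // mul1r.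
  rewrite -natrX ler_nat ltnW //.
  by have := prefix_lt 2 c 0 n c_lt; rewrite add0n muln1.
exists (limn u); split=> //.
have := @prefix_bounds R 2 c _ c_lt cvgu _ 0%N; rewrite expr0 mul1r; apply.
by apply: contra_not not_tail; apply: filterS => j; case: (c j).
Qed.

(** The binary digits of the sum of the 2^-(t i) over the i with [beta i]; the
    digit at index j has weight 2^-(j+1). *)
Definition lacunary_digit (t : nat -> nat) (beta : nat -> bool) (j : nat) :
    bool :=
  `[< exists2 i, t i = j.+1 & beta i >].

Lemma lacunary_digit_gap (t : nat -> nat) (beta : nat -> bool) (i j : nat) :
  {homo t : i j / (i < j)%N} -> (t i <= j)%N -> (j.+1 < t i.+1)%N ->
  lacunary_digit t beta j = false.
Proof.
move=> t_lt ij ji; apply/asboolPn => -[k kj _].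
have t_le : {homo t : i j / (i <= j)%N} by exact: ltnW_homo.
by have [/t_le|/t_le] := leqP k i; lia.
Qed.

Lemma lacunary_digit_pred (t : nat -> nat) (beta : nat -> bool) (i : nat) :
  {homo t : i j / (i < j)%N} -> (0 < t i)%N ->
  lacunary_digit t beta (t i).-1 = beta i.
Proof.
move=> t_lt ti; apply/asboolP/idP => [[k]|bi]; last first.
  by exists i; rewrite ?prednK.
rewrite prednK // => tk bk; suff <- : k = i by [].
by case: (ltngtP k i) => // /t_lt; rewrite tk ltnn.
Qed.

(** Cantor's diagonal argument: the composite of [f] with an injection from [A]
    to the natural numbers would code 0-1 sequences by natural numbers. *)
Lemma uncountable_of_injection (T : Type) (A : set T)
    (f : (nat -> bool) -> T) :
  injective f -> (forall beta, A (f beta)) -> ~ countable A.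
Proof.
move=> f_inj Af /countable_injP[h h_inj].
have g_inj beta beta' : h (f beta) = h (f beta') -> beta = beta'.
  by move=> /h_inj E; apply/f_inj/E; rewrite inE.
pose diag n := `[< exists2 beta, h (f beta) = n & ~~ beta n >].
have : diag (h (f diag)) = ~~ diag (h (f diag)).
  apply/asboolP/idP => [[beta /g_inj ->] //|D].
  by exists diag.
by case: (diag _).
Qed.

(** The factor 3 b makes 2^(t_(i+1) - 1) at least b^(3 t_i), and the summand 2
    leaves a 0 at the place after each t_i, so that no lacunary sum ends with
    a tail of ones. *)
Lemma lacunary_sequence (S : set nat) (b : nat) :
  (forall N, exists2 n, (N <= n)%N & S n) ->
  exists t : nat -> nat,
    forall i, [/\ S (t i), (0 < t i)%N & (3 * b * t i + 2 <= t i.+1)%N].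
Proof.
move=> S_unbounded.
have /choice[f fP] N : exists n, (N <= n)%N /\ S n.
  by have [n] := S_unbounded N; exists n.
pose t := fix t i := if i is i'.+1 then f (3 * b * t i' + 2)%N else f 1%N.
exists t => i; split; last by rewrite /=; case: (fP (3 * b * t i + 2)%N).
- by case: i => [|i] /=; [case: (fP 1%N)|case: (fP (3 * b * t i + 2)%N)].
- by case: i => [|i] /=; [case: (fP 1%N)|case: (fP (3 * b * t i + 2)%N); lia].
Qed.

(** * The uncountable family *)

Theorem theorem2 (R : realType) (S : set nat)
    (S_pos : forall n : nat, S n -> (0 < n)%N) (S_sparse : sparse R S)
    (b : nat) (b_base : (2 <= b)%N) (b_even : ~~ odd b) :
  ~ countable
      [set x : R | cantor_set S x /\
        forall b' : nat, (2 <= b')%N -> ~~ odd b' -> (b' <= b)%N ->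
          ~ normal_in_base b' x].
Proof.
have [t tP] := lacunary_sequence S b (sparse_unbounded R S S_sparse).
have t_step i : (t i + 2 <= t i.+1)%N by case: (tP i); nia.
have t_lt : {homo t : i j / (i < j)%N}.
  by apply: homo_ltn => [|i]; [exact: ltn_trans|have := t_step i; lia].
have t_gt i : (i < t i)%N.
  by elim: i => [|i IHi]; [case: (tP 0%N)|have := t_lt i i.+1 (leqnn _); lia].
(* The digit of index [t n], of weight 2^-(t n + 1), falls into a gap. *)
have not_tail beta : ~ (\forall j \near \oo, lacunary_digit t beta j).
  move=> [n _ /= /(_ (t n)) tail]; have := tail (ltnW (t_gt n)).
  by rewrite (@lacunary_digit_gap _ _ n) //; have := t_step n; lia.
have /choice[f fP] beta := binary_point R _ (not_tail beta).
have fE beta n :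
    prefix 2 (lacunary_digit t beta) n = Num.trunc (2 ^+ n * f beta).
  have [_ cvf] := fP beta.
  apply: prefix_trunc cvf _ n => [j|]; first by case: lacunary_digit.
  apply: contra_not (not_tail beta); apply: filterS => j.
  by case: lacunary_digit.
apply: (@uncountable_of_injection _ _ f) => [beta beta' fbb|beta].
  apply/funext => i; have [_ ti _] := tP i.
  rewrite -(lacunary_digit_pred t beta i t_lt ti).
  rewrite -(lacunary_digit_pred t beta' i t_lt ti).
  pose digit gamma j := lacunary_digit t gamma j : nat.
  have: digit beta (t i).-1 = digit beta' (t i).-1.
    rewrite (digit_prefix 2 (digit beta)) (digit_prefix 2 (digit beta')).
    by rewrite !fE fbb.
  by rewrite /digit; do 2![case: lacunary_digit].
have [f01 cvf] := fP beta; split.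
  split=> //; exists (fun k => lacunary_digit t beta k.-1).
  rewrite -cvg_shiftS.
  rewrite (_ : [sequence _]_n =
    series (fun j => (lacunary_digit t beta j)%:R * 2 ^- j.+1)) //.
  apply/funext => n; rewrite /series /= big_nat_recl // asboolF; last first.
    by move=> /S_pos.
  rewrite mul0r add0r; apply: eq_bigr => j _; congr (_%:R * _).
  case: (asboolP (S j.+1)) => //= nSj.
  rewrite /lacunary_digit asboolF // => -[i ti _].
  by apply: nSj; rewrite -ti; case: (tP i).
(* Normality in base b' includes simple normality in base b' itself. *)
move=> b' b'_ge2 b'_even b'b /(_ 1%N isT); rewrite expn1.
apply: not_simply_normal_of_gaps => // n0; exists (t n0) => //.
have [_ tn tn1] := tP n0.
have -> : (2 * t n0 = 3 * t n0 - t n0)%N by lia.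
apply: (@trunc_gap _ _ _ (t n0.+1).-1) => //; [lia|by case/andP: f01|lia| |].
  apply: (@leq_trans (2 ^ (b * (3 * t n0)))).
    rewrite [in leqRHS]expnM leq_exp2r; last by lia.
    by rewrite (leq_trans b'b) // ltnW // ltn_expl.
  by rewrite leq_exp2l //; nia.
rewrite -!fE; have := t_step n0 => ?.
have -> : ((t n0.+1).-1 = t n0 + ((t n0.+1).-1 - t n0))%N by lia.
rewrite [X in (2 ^ X)%N]addKn prefix_gap // => j jt.
by rewrite (@lacunary_digit_gap _ _ n0) //; lia.
Qed.
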